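(* Let $\xi,\zeta>1$, let $G$ be a symmetric multi-star graph with $m$ center agents and $K-m$ peripheral agents, let $p\in[0,1]$ be the broadcasting probability, and suppose that $p(K-m)/m>1$. Define $$B_{het}= c_1\sum_{i:\,\Delta_i>0}\frac{8\sigma_i^2(\xi+1)\log T}{\Delta_i} + \frac{2}{\log \zeta}\sum_{i=1}^N\Delta_i \left( K\log (1+d_{avg}) +(K-m)\frac{\xi\log 2 + 1}{\xi^2} + m\,\frac{\log (1+d_{cen})(\xi\alpha+\xi+\alpha) + 1}{(\xi\alpha+\xi+\alpha)^2} \right)$$ (the upper bound on expected cumulative group regret under the heterogeneous sampling rules) and $$B_{hom}= c_2\sum_{i:\,\Delta_i>0}\frac{8\sigma_i^2(\xi+1)\log T}{\Delta_i} + \frac{2}{\log \zeta}\sum_{i=1}^N\Delta_i \left( K\log (1+d_{avg}) +(K-m)\frac{\xi\log 2 + 1}{\xi^2} + m\,\frac{\log (1+d_{cen})\,\xi + 1}{\xi^2} \right)$$ (the upper bound under the corresponding homogeneous sampling rules), where $$c_1 = K-m + \frac{m(1+\alpha)}{1+p(m-1)}\left[1-p\,\frac{K-m}{m}\right]^+,\qquad c_2=K-m+\frac{m}{1+p(m-1)}\left[1-p\,\frac{K-m}{m}\right]^+ .$$ Then $c_1=c_2=K-m$, $$\frac{\log (1+d_{cen})(\xi\alpha+\xi+\alpha) + 1}{(\xi\alpha+\xi+\alpha)^2} < \frac{\log (1+d_{cen})\xi + 1}{\xi^2},$$ and, if at least one option is sub-optimal, $B_{het}<B_{hom}$.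
   Context: There are $N$ options with mean rewards $\mu_1,\dots,\mu_N$ and variance proxies $\sigma_i^2>0$; $\Delta_i=\max_j\mu_j-\mu_i\ge0$, and an option $i$ is sub-optimal if $\Delta_i>0$. $T\ge1$ is the number of time steps. Symmetric multi-star graph with $K$ agents and $m$ center agents: an undirected graph in which agents $k\le m$ (center agents) are all neighbors of one another, each agent $k>m$ (peripheral agent) has exactly one neighbor, which is a center agent, and all center agents have the same number of neighbors (so $K-m$ is an integer multiple of $m$). $d_k$ is the degree of agent $k$; $d_{avg}=\frac1K\sum_{k=1}^Kd_k$; $d_k^{avg}$ is the average degree of the neighbors of $k$; $d_{cen}=\frac{K-m}{m}+m-1$ is the degree of each center agent. $\alpha$ is the common value, over center agents $k\le m$, of the exploration bias $\alpha_k=\dfrac{p^{1-p}(d_k-d_k^{avg})}{d_k}$ used in the heterogeneous sampling rules: these are upper-confidence-bound rules in which agent $k$ maximizes over $i$ the quantity (estimated mean of option $i$) $+\,\sigma_i\sqrt{2(1+\alpha_k)(\xi+1)\log t/N_i^k(t)}$, with $N_i^k(t)$ the number of observations of option $i$ by agent $k$ up to time $t$, and with $\alpha_k=0$ for peripheral agents. The corresponding homogeneous rules have $\alpha_k=0$ for all $k$. $[x]^+=\max\{x,0\}$. *)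

(* Defs.v *)
(* Mathematical Components with MathComp-Analysis (R : realType). *)
From HB Require Import structures.
From mathcomp Require Import all_boot all_order all_algebra.
From mathcomp Require Import reals exp.

Set Implicit Arguments.
Unset Strict Implicit.
Unset Printing Implicit Defensive.

Import Order.TTheory GRing.Theory Num.Theory.
Local Open Scope ring_scope.

(* A graph on K agents is a relation e : rel 'I_K.  Agents are numbered from 0,
   so the m center agents are those k : 'I_K with k < m. *)

Definition degree (K : nat) (e : rel 'I_K) (k : 'I_K) : nat :=
  #|[set l | e k l]|.

Record symmetric_multi_star (K m : nat) (e : rel 'I_K) : Prop :=
  SymmetricMultiStar {
    sms_sym : symmetric e;
    sms_irr : irreflexive e;
    sms_centers_gt0 : (0 < m)%N;
    sms_centers_le : (m <= K)%N;
    sms_centers_adj :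
      forall k l : 'I_K, (k < m)%N -> (l < m)%N -> k != l -> e k l;
    sms_peripheral :
      forall k : 'I_K, (m <= k)%N ->
        exists2 c : 'I_K, (c < m)%N & forall l : 'I_K, e k l = (l == c);
    sms_centers_degree :
      forall k l : 'I_K, (k < m)%N -> (l < m)%N -> degree e k = degree e l
  }.

Section Bounds.
Variable R : realType.

Definition avg_degree (K : nat) (e : rel 'I_K) : R :=
  K%:R^-1 * \sum_(k < K) (degree e k)%:R.

Definition neighbor_avg_degree (K : nat) (e : rel 'I_K) (k : 'I_K) : R :=
  (\sum_(l < K | e k l) (degree e l)%:R) / (degree e k)%:R.

Definition center_degree (K m : nat) : R :=
  (K%:R - m%:R) / m%:R + m%:R - 1.

Definition exploration_bias (K m : nat) (e : rel 'I_K) (p : R) (k : 'I_K) : R :=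
  if (k < m)%N then
    p `^ (1 - p) * ((degree e k)%:R - neighbor_avg_degree e k)
      / (degree e k)%:R
  else 0.

(* The default value mu i of the iterated maximum is itself one of the mu j. *)
Definition gap (N : nat) (mu : 'I_N -> R) (i : 'I_N) : R :=
  \big[Num.max/mu i]_(j < N) mu j - mu i.

Definition coef_het (K m : nat) (p alpha : R) : R :=
  K%:R - m%:R
  + m%:R * (1 + alpha) / (1 + p * (m%:R - 1))
    * Num.max (1 - p * ((K%:R - m%:R) / m%:R)) 0.

Definition coef_hom (K m : nat) (p : R) : R :=
  K%:R - m%:R
  + m%:R / (1 + p * (m%:R - 1))
    * Num.max (1 - p * ((K%:R - m%:R) / m%:R)) 0.

Definition center_term_het (K m : nat) (xi alpha : R) : R :=
  (ln (1 + center_degree K m) * (xi * alpha + xi + alpha) + 1)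
  / (xi * alpha + xi + alpha) ^+ 2.

Definition center_term_hom (K m : nat) (xi : R) : R :=
  (ln (1 + center_degree K m) * xi + 1) / xi ^+ 2.

Definition bound_het (N K m T : nat) (e : rel 'I_K) (mu sigma : 'I_N -> R)
    (p xi zeta alpha : R) : R :=
  coef_het K m p alpha
    * (\sum_(i < N | 0 < gap mu i)
         8 * sigma i ^+ 2 * (xi + 1) * ln T%:R / gap mu i)
  + 2 / ln zeta
    * (\sum_(i < N)
         gap mu i
         * (K%:R * ln (1 + avg_degree e)
            + (K%:R - m%:R) * ((xi * ln 2 + 1) / xi ^+ 2)
            + m%:R * center_term_het K m xi alpha)).

Definition bound_hom (N K m T : nat) (e : rel 'I_K) (mu sigma : 'I_N -> R)
    (p xi zeta : R) : R :=
  coef_hom K m p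
    * (\sum_(i < N | 0 < gap mu i)
         8 * sigma i ^+ 2 * (xi + 1) * ln T%:R / gap mu i)
  + 2 / ln zeta
    * (\sum_(i < N)
         gap mu i
         * (K%:R * ln (1 + avg_degree e)
            + (K%:R - m%:R) * ((xi * ln 2 + 1) / xi ^+ 2)
            + m%:R * center_term_hom K m xi)).

End Bounds.

(* Main.v *)
(** Each center agent has [m - 1] center neighbors and, by double counting the
    edges between centers and peripheral agents, [q = (K - m) / m] peripheral
    neighbors, all of degree 1.  With [d = m - 1 + q] the neighbors of a center
    thus have average degree [((m - 1) d + q) / d], which is below [d] because
    [q > 1]; hence [alpha > 0].  Then [xi * alpha + xi + alpha > xi], and
    [x |-> (L * x + 1) / x ^+ 2 = L / x + 1 / x ^+ 2] is strictly decreasing for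
    [L >= 0].  Since [p * q > 1], the positive parts in both leading
    coefficients vanish. *)
Require Import Defs.
From HB Require Import structures.
From mathcomp Require Import all_boot all_order all_algebra.
From mathcomp Require Import reals exp.
From mathcomp Require Import ring lra.

Set Implicit Arguments.
Unset Strict Implicit.
Unset Printing Implicit Defensive.

Import Order.TTheory GRing.Theory Num.Theory.
Local Open Scope ring_scope.

(** The number [q], kept in [nat] so that [1 < q] can later be read off from an inequality between
    reals. *)
Definition peripheral_neighbors (K m : nat) (e : rel 'I_K) (k : 'I_K) : nat :=
  #|[set l | e k l & (m <= l)%N]|.

Lemma card_ord_lt (K m : nat) : (m <= K)%N -> #|[set l : 'I_K | (l < m)%N]| = m.
Proof.
move=> le_mK; rewrite -sum1_card.
under eq_bigl do rewrite inE.
by rewrite -(big_ord_widen _ (fun=> 1%N)) // sum1_card card_ord.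
Qed.

Lemma card_ord_ge (K m : nat) :
  (m <= K)%N -> #|[set l : 'I_K | (m <= l)%N]| = (K - m)%N.
Proof.
move=> le_mK; rewrite -[RHS](congr1 (subn K) (card_ord_lt le_mK)).
have <- : ~: [set l : 'I_K | (l < m)%N] = [set l : 'I_K | (m <= l)%N].
  by apply/setP => l; rewrite !inE -leqNgt.
by rewrite cardsCs setCK card_ord.
Qed.

Section MultiStar.
Variables (K m : nat) (e : rel 'I_K).
Hypothesis hG : symmetric_multi_star m e.

Lemma degree_peripheral (k : 'I_K) : (m <= k)%N -> degree e k = 1%N.
Proof.
move=> /(sms_peripheral hG)[c _ ek]; rewrite /degree -(cards1 c).
by apply: eq_card => l; rewrite !inE ek.
Qed.

(** Centers are pairwise adjacent and [e] is irreflexive, so these neighbors are all centers but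
    [k]. *)
Lemma card_center_neighbors (k : 'I_K) :
  (k < m)%N -> #|[set l | e k l & (l < m)%N]| = m.-1.
Proof.
move=> km.
have -> : [set l | e k l & (l < m)%N] = [set l : 'I_K | (l < m)%N] :\ k.
  apply/setP => l; rewrite !inE; have [->|lk] := eqVneq l k.
    by rewrite (sms_irr hG).
  rewrite andTb; have [lm|] := boolP (l < m)%N; last by rewrite andbF.
  by rewrite (sms_centers_adj hG) // eq_sym.
have := cardsD1 k [set l : 'I_K | (l < m)%N].
by rewrite card_ord_lt ?(sms_centers_le hG) // inE km => /(congr1 predn).
Qed.

Lemma degree_center (k : 'I_K) :
  (k < m)%N -> degree e k = (m.-1 + peripheral_neighbors m e k)%N.
Proof.
move=> km; rewrite -(card_center_neighbors km) /degree /peripheral_neighbors.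
rewrite -!sum1_card (bigID (fun l : 'I_K => (l < m)%N)) /=.
by congr addn; apply: eq_bigl => l; rewrite !inE // -leqNgt.
Qed.

(** Center neighbors share the degree of [k]; peripheral ones have degree 1. *)
Lemma sum_degree_center (k : 'I_K) : (k < m)%N ->
  (\sum_(l < K | e k l) degree e l =
     m.-1 * degree e k + peripheral_neighbors m e k)%N.
Proof.
move=> km; rewrite (bigID (fun l : 'I_K => (l < m)%N)) /=; congr addn.
  rewrite -(card_center_neighbors km) -sum_nat_const.
  apply: eq_big => l; first by rewrite inE.
  by case/andP => _ lm; apply: (sms_centers_degree hG).
rewrite /peripheral_neighbors -sum1_card.
apply: eq_big => l; first by rewrite inE -leqNgt.
by rewrite -leqNgt => /andP[_ ml]; rewrite degree_peripheral.
Qed.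

Lemma mul_peripheral_neighbors (k : 'I_K) :
  (k < m)%N -> (m * peripheral_neighbors m e k = K - m)%N.
Proof.
move=> km; have le_mK := sms_centers_le hG.
transitivity (\sum_(l < K | (l < m)%N) peripheral_neighbors m e l)%N.
  rewrite -{1}(card_ord_lt le_mK) -sum_nat_const.
  apply: eq_big => l; first by rewrite inE.
  (* Adding the [m.-1] center neighbors turns both counts into degrees of centers, which agree. *)
  rewrite inE => lm; apply: (@addnI m.-1).
  by rewrite -!degree_center //; apply: (sms_centers_degree hG).
rewrite -(card_ord_ge le_mK) -sum1_card.
transitivity (\sum_(l < K | (l < m)%N) \sum_(j < K | e l j && (m <= j)%N) 1)%N.
  apply: eq_bigr => l _; rewrite /peripheral_neighbors -sum1_card.
  by apply: eq_bigl => j; rewrite inE.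
rewrite (exchange_big_dep (fun j : 'I_K => (m <= j)%N)) /=; last first.
  by move=> l j _ /andP[].
apply: eq_big => j; first by rewrite inE.
move=> mj; have [c cm ej] := sms_peripheral hG mj.
(* After the exchange, each peripheral [j] is counted once, at its only neighbor [c]. *)
rewrite (big_pred1 c) // => l /=; rewrite mj andbT (sms_sym hG) ej.
by case: eqVneq => [->|_]; rewrite ?cm ?andbF.
Qed.

Lemma exploration_bias_gt0 (R : realType) (p : R) (k : 'I_K) :
  0 < p -> (k < m)%N -> (1 < peripheral_neighbors m e k)%N ->
  0 < exploration_bias m e p k.
Proof.
move=> p0 km q1; rewrite /exploration_bias km.
set q := peripheral_neighbors m e k in q1.
have dE : degree e k = (m.-1 + q)%N by exact: degree_center.
have d1 : (1 < degree e k)%N by rewrite dE (leq_trans q1) ?leq_addl.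
have d0 : 0 < (degree e k)%:R :> R by rewrite ltr0n ltnW.
apply: divr_gt0 => //; apply: mulr_gt0; first exact: powR_gt0.
rewrite subr_gt0 /neighbor_avg_degree -natr_sum sum_degree_center // -/q.
(* With [d = m.-1 + q] expanded in one factor of [d * d], the claim reduces to [q < q * d]. *)
rewrite ltr_pdivrMr // -natrM ltr_nat [X in (_ < X * _)%N]dE mulnDl ltn_add2l.
by rewrite -[X in (X < _)%N]muln1 ltn_pmul2l // ltnW.
Qed.

End MultiStar.

Lemma affine_over_sqr_decreasing (R : realFieldType) (L x y : R) :
  0 <= L -> 0 < x -> x < y -> (L * y + 1) / y ^+ 2 < (L * x + 1) / x ^+ 2.
Proof.
move=> L0 x0 xy; have y0 : 0 < y := lt_trans x0 xy.
have E z : 0 < z -> (L * z + 1) / z ^+ 2 = L * z^-1 + z^-1 ^+ 2.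
  by move=> z0; have zn0 := lt0r_neq0 z0; field.
rewrite !E //; have yx : y^-1 < x^-1 by rewrite ltf_pV2 // posrE.
(* Strictness comes from the squares, since [L] may be 0. *)
apply: ler_ltD; first by rewrite ler_wpM2l // ltW.
by rewrite ltrXn2r // ?invr_ge0 ltW // invr_gt0.
Qed.

Lemma gap_ge0 (R : realType) (N : nat) (mu : 'I_N -> R) (i : 'I_N) :
  0 <= gap mu i.
Proof. by rewrite /gap subr_ge0 bigmax_idl le_max lexx. Qed.

(* The common value of the exploration bias over the center agents is its value
   at an arbitrary center agent c. *)
Theorem mainTheorem2 (R : realType) (N K m T : nat) (e : rel 'I_K)
    (mu sigma : 'I_N -> R) (p xi zeta : R) (c : 'I_K)
    (hT : (1 <= T)%N)
    (hsigma : forall i : 'I_N, 0 < sigma i ^+ 2)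
    (hxi : 1 < xi) (hzeta : 1 < zeta)
    (hG : symmetric_multi_star m e)
    (hc : (c < m)%N)
    (hp : 0 <= p <= 1)
    (hpKm : 1 < p * (K%:R - m%:R) / m%:R) :
  let alpha := exploration_bias m e p c in
  [/\ coef_het K m p alpha = K%:R - m%:R,
      coef_hom K m p = K%:R - m%:R,
      center_term_het K m xi alpha < center_term_hom K m xi
    & (exists i : 'I_N, 0 < gap mu i) ->
      bound_het m T e mu sigma p xi zeta alpha
        < bound_hom m T e mu sigma p xi zeta].
Proof.
move=> alpha; have [p0 p1] := andP hp; have le_mK := sms_centers_le hG.
have m0 : 0 < m%:R :> R by rewrite ltr0n (sms_centers_gt0 hG).
have qE : (K%:R - m%:R) / m%:R = (peripheral_neighbors m e c)%:R :> R.
  rewrite -natrB // -(mul_peripheral_neighbors hG hc) natrM mulrC mulKf //.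
  exact: lt0r_neq0.
have pq : 1 < p * (peripheral_neighbors m e c)%:R by rewrite -qE mulrA.
have p_gt0 : 0 < p.
  by rewrite lt_neqAle p0 andbT; apply/eqP => p00; move: pq; rewrite -p00; lra.
(* Since [p <= 1], [1 < p * q <= q]. *)
have q1 : (1 < peripheral_neighbors m e c)%N.
  by rewrite -(ltr_nat R) (lt_le_trans pq) // ler_piMl.
have a0 : 0 < alpha by exact: exploration_bias_gt0 q1.
have max0 : Num.max (1 - p * ((K%:R - m%:R) / m%:R)) 0 = 0.
  by apply/max_idPr; rewrite qE; lra.
have het : coef_het K m p alpha = K%:R - m%:R.
  by rewrite /coef_het max0 mulr0 addr0.
have hom : coef_hom K m p = K%:R - m%:R by rewrite /coef_hom max0 mulr0 addr0.
have lt_center : center_term_het K m xi alpha < center_term_hom K m xi.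
  apply: affine_over_sqr_decreasing; [|lra|nra].
  have m1 : 1 <= m%:R :> R by rewrite ler1n (sms_centers_gt0 hG).
  have q0 : 0 <= (K%:R - m%:R) / m%:R :> R by rewrite qE.
  by apply: ln_ge0; rewrite /center_degree; lra.
split=> // -[i gap_i]; rewrite /bound_het /bound_hom het hom ltrD2l.
rewrite ltr_pM2l; last by rewrite divr_gt0 // ln_gt0.
(* The sub-optimal option [i] gives the strict inequality; the other gaps may vanish, so their terms
   are compared weakly. *)
rewrite (bigD1 i) //= [ltRHS](bigD1 i) //=.
apply: ltr_leD; first by rewrite ltr_pM2l // ltrD2l ltr_pM2l.
apply: ler_sum => j _; rewrite ler_wpM2l ?gap_ge0 // lerD2l ler_pM2l //.
exact: ltW.
Qed.
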